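(* Let $\Psi$ be the invariant of labeled posets with values in $\mathbb Q[t]$ defined recursively by $\Psi(\emptyset)=1$ and, for every non-empty labeled poset $(P,\omega)$, $$\Psi(P,\omega)=\Delta^{-1}\sum_{\emptyset\ne S\in\mathcal I_\omega(P)}\Psi(P\setminus S,\omega).$$ Then $\Psi(P,\omega)=\Omega(P,\omega;t)$ for every finite labeled poset $(P,\omega)$.
   Context: All posets are finite and $\mathbb N^+=\{1,2,\dots\}$, $[n]=\{1,\dots,n\}$. An ideal of a poset $P$ is a down-closed subset (including $\emptyset$ and $P$). A labeled poset $(P,\omega)$ is a finite poset $P$ with an injective map $\omega:P\to\mathbb N^+$; each subset $S\subseteq P$ carries the induced order and labeling, giving a labeled poset $(S,\omega)$. A subset $S$ is $\omega$-natural if $\omega|_S$ is order-preserving; $\mathcal I_\omega(P)$ is the set of ideals of $P$ that are $\omega$-natural. A map $f:P\to[n]$ is $\omega$-order-preserving if it is order-preserving and $f(x)>f(y)$ whenever $x>y$ in $P$ and $\omega(x)<\omega(y)$. The order polynomial $\Omega(P,\omega;t)$ is the unique polynomial in $t$ whose value at each $n\in\mathbb N^+$ is the number of $\omega$-order-preserving maps $P\to[n]$; $\Omega(\emptyset,\omega;t)=1$. The operator $\Delta$ on $\mathbb Q[t]$ is $(\Delta f)(t)=f(t+1)-f(t)$, and $\Delta^{-1}$ is the linear operator on $\mathbb Q[t]$ sending $f$ to the unique polynomial $g$ with $g(0)=0$ and $\Delta g=f$. *)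

(* Defs.v *)
From HB Require Import structures.
From mathcomp Require Import all_boot all_order all_algebra.

Set Implicit Arguments.
Unset Strict Implicit.
Unset Printing Implicit Defensive.

Import Order.TTheory GRing.Theory Num.Theory.
Local Open Scope ring_scope.

Lemma eq_poly_nat (p q : {poly rat}) :
  (forall n : nat, (0 < n)%N -> p.[n%:R] = q.[n%:R]) -> p = q.
Proof.
move=> pq; apply/eqP; rewrite -subr_eq0; apply/eqP.
pose s := [seq (i.+1)%:R | i <- iota 0 (size (p - q))] : seq rat.
apply: (@roots_geq_poly_eq0 _ _ s).
- by apply/allP=> _ /mapP[i _ ->]; rewrite rootE !hornerE pq // subrr.
- rewrite map_inj_uniq ?iota_uniq // => i j /eqP.
  by rewrite eqr_nat eqSS => /eqP.
- by rewrite size_map size_iota.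
Qed.

(* The polynomial t (t - 1) ... (t - k + 1) / k!. *)
Definition binom_poly (k : nat) : {poly rat} :=
  (k`!%:R)^-1 *: \prod_(i < k) ('X - (nat_of_ord i)%:R%:P).

Lemma binom_polyE k n : (binom_poly k).[n%:R] = 'C(n, k)%:R.
Proof.
rewrite /binom_poly hornerZ horner_prod.
have -> : \prod_(i < k) ('X - (nat_of_ord i)%:R%:P).[n%:R] = (n ^_ k)%:R :> rat.
  elim: k => [|k IH]; first by rewrite big_ord0.
  rewrite big_ord_recr /= IH hornerXsubC ffactnSr natrM.
  have [le_kn|lt_nk] := leqP k n; first by rewrite natrB.
  by rewrite ffact_small // !mul0r.
by rewrite -bin_ffact natrM mulrC mulfK // pnatr_eq0 -lt0n fact_gt0.
Qed.

Lemma size_binom_poly k : size (binom_poly k) = k.+1.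
Proof.
rewrite size_scale ?invr_eq0 ?pnatr_eq0 -?lt0n ?fact_gt0 //.
by rewrite size_prod_XsubC /index_enum -enumT size_enum_ord.
Qed.

Definition fdiff (f : {poly rat}) : {poly rat} := f \Po ('X + 1%:P) - f.

Lemma fdiffE f (a : rat) : (fdiff f).[a] = f.[a + 1] - f.[a].
Proof. by rewrite /fdiff !hornerE horner_comp !hornerE. Qed.

Lemma fdiff_is_linear : linear fdiff.
Proof.
by move=> a f g; rewrite /fdiff comp_polyD comp_polyZ scalerBr addrACA -opprD.
Qed.

Lemma fdiff_binom_poly k : fdiff (binom_poly k.+1) = binom_poly k.
Proof.
apply: eq_poly_nat => n _.
by rewrite fdiffE natr1 !binom_polyE binS natrD addrAC subrr add0r.
Qed.

Lemma fdiff_inv_exists (f : {poly rat}) :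
  {g : {poly rat} | g.[0] = 0 /\ fdiff g = f}.
Proof.
have [n] : {n | (size f <= n)%N} by exists (size f).
elim: n f => [|n IHn] f.
  rewrite size_poly_leq0 => /eqP ->; exists 0; rewrite horner0; split=> //.
  by rewrite /fdiff comp_poly0 subrr.
move=> szf; pose b := binom_poly n; pose c := f`_n / b`_n.
have bn0 : b`_n != 0.
  have := lead_coef_eq0 b.
  by rewrite lead_coefE size_binom_poly -size_poly_eq0 size_binom_poly => ->.
have [|g [g0 gE]] := IHn (f - c *: b).
  apply/leq_sizeP => j; rewrite leq_eqVlt => /predU1P[<-|lt_nj].
    by rewrite coefB coefZ divfK // subrr.
  rewrite coefB coefZ (nth_default _ (leq_trans szf lt_nj)).
  by rewrite nth_default ?mulr0 ?subrr // size_binom_poly.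
exists (c *: binom_poly n.+1 + g); split.
  by rewrite hornerD hornerZ g0 (binom_polyE _ 0) bin0n mulr0 addr0.
by rewrite fdiff_is_linear gE fdiff_binom_poly addrC subrK.
Qed.

Definition fdiff_inv (f : {poly rat}) : {poly rat} := sval (fdiff_inv_exists f).

Lemma fdiff_inv0 f : (fdiff_inv f).[0] = 0.
Proof. by rewrite /fdiff_inv; case: fdiff_inv_exists => g []. Qed.

Lemma fdiff_invK : cancel fdiff_inv fdiff.
Proof. by move=> f; rewrite /fdiff_inv; case: fdiff_inv_exists => g []. Qed.

Lemma fdiff_inv_uniq f g : g.[0] = 0 -> fdiff g = f -> g = fdiff_inv f.
Proof.
move=> g0 gE; apply: eq_poly_nat => n _.
elim: n => [|n IHn]; first by rewrite g0 fdiff_inv0.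
have := congr1 (horner^~ n%:R) (etrans gE (esym (fdiff_invK f))).
by rewrite /= !fdiffE natr1 (IHn) => /addIr.
Qed.

Lemma fdiff_inv_is_linear : linear fdiff_inv.
Proof.
move=> a f g; apply/esym/fdiff_inv_uniq.
  by rewrite hornerD hornerZ !fdiff_inv0 mulr0 addr0.
by rewrite fdiff_is_linear !fdiff_invK.
Qed.

Record labeledPoset := LabeledPoset {
  lp_disp : Order.disp_t;
  lp_sort :> finPOrderType lp_disp;
  label : lp_sort -> nat;
  label_inj : injective label;
  label_gt0 : forall x, (0 < label x)%N
}.

Arguments label {l} x.

Section SubLabeledPoset.
Variables (P : labeledPoset) (S : {set P}).

Definition sub_carrier : Type := {x : P | x \in S}.

HB.instance Definition _ := SubType.on sub_carrier.
HB.instance Definition _ := [Finite of sub_carrier by <:].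
HB.instance Definition _ :=
  [SubChoice_isSubPOrder of sub_carrier by <: with lp_disp P].

Definition sub_label (u : sub_carrier) : nat := label (val u).

Lemma sub_label_inj : injective sub_label.
Proof. by move=> u v /label_inj /val_inj. Qed.

Lemma sub_label_gt0 u : (0 < sub_label u)%N.
Proof. exact: label_gt0. Qed.

Definition sub_poset : labeledPoset := LabeledPoset sub_label_inj sub_label_gt0.

Lemma sub_poset_leE (u v : sub_poset) : (u <= v)%O = (val u <= val v)%O.
Proof. by []. Qed.

Lemma card_sub_poset : #|sub_poset| = #|S|.
Proof. by rewrite -(card_sig (mem S)). Qed.

End SubLabeledPoset.

Section Invariants.
Variable P : labeledPoset.

Definition ideal (S : {set P}) : bool :=
  [forall x, forall y, (x \in S) && (y <= x)%O ==> (y \in S)].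

Definition label_natural (S : {set P}) : bool :=
  [forall x in S, forall y in S, (x <= y)%O ==> (label x <= label y)%N].

Definition natural_ideals : {set {set P}} := [set S | ideal S & label_natural S].

(* ['I_n] stands for the chain [n]: only the order of the values matters. *)
Definition label_order_preserving (n : nat) (f : {ffun P -> 'I_n}) : bool :=
  [forall x, forall y, (x <= y)%O ==> (f x <= f y)%N] &&
  [forall x, forall y,
     (y < x)%O && (label x < label y)%N ==> (f y < f x)%N].

Definition order_count (n : nat) : nat :=
  #|[set f : {ffun P -> 'I_n} | label_order_preserving f]|.

Let onto_count (k : nat) : nat :=
  #|[set f : {ffun P -> 'I_k} |
      label_order_preserving f & f @: [set: P] == setT]|.

Let card_image n (A : {set 'I_n}) :
  #|[set f : {ffun P -> 'I_n} |
      label_order_preserving f & f @: [set: P] == A]| = onto_count #|A|.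
Proof.
pose ev (i : 'I_#|A|) : 'I_n := Order.enum_val i.
have ev_inj : injective ev by exact: Order.enum_val_inj.
have ev_le i j : (ev i <= ev j)%N = (i <= j)%N.
  exact: (Order.le_enum_val (@le_total _ _) i j).
have ev_lt i j : (ev i < ev j)%N = (i < j)%N by rewrite !ltnNge ev_le.
pose h (g : {ffun P -> 'I_#|A|}) : {ffun P -> 'I_n} := [ffun x => ev (g x)].
have h_inj : injective h.
  by move=> g g' /ffunP gg'; apply/ffunP => x; have := gg' x; rewrite !ffunE => /ev_inj.
have h_pres g : label_order_preserving (h g) = label_order_preserving g.
  congr (_ && _); apply: eq_forallb => x; apply: eq_forallb => y; rewrite !ffunE.
    by rewrite ev_le.
  by rewrite ev_lt.
have ev_A i : ev i \in A by exact: Order.enum_valP.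
have ev_T : ev @: setT = A.
  apply/eqP; rewrite eqEcard card_imset // cardsT card_ord leqnn andbT.
  by apply/subsetP => _ /imsetP[i _ ->].
have h_im g : h g @: setT = ev @: (g @: setT).
  by rewrite -imset_comp; apply: eq_imset => x; rewrite /= ffunE.
rewrite /onto_count -(card_imset _ h_inj); apply: eq_card => f; rewrite inE.
apply/andP/imsetP => [[f_pres /eqP fA]|[g]].
  have fP x : exists i, ev i == f x.
    have : f x \in ev @: setT by rewrite ev_T -fA imset_f.
    by move=> /imsetP[i _ ->]; exists i.
  pose g := [ffun x => xchoose (fP x)].
  have fE : f = h g.
    by apply/ffunP => x; rewrite !ffunE (eqP (xchooseP (fP x))).
  exists g => //; rewrite inE -h_pres -fE f_pres /=.
  by apply/eqP/(imset_inj ev_inj); rewrite -h_im -fE fA ev_T.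
by rewrite inE => /andP[g_pres /eqP gT] ->; rewrite h_pres h_im gT ev_T.
Qed.

Let order_count_sum n :
  order_count n = (\sum_(k < #|P|.+1) onto_count k * 'C(n, k))%N.
Proof.
have im_le (f : {ffun P -> 'I_n}) : (#|f @: [set: P]| < #|P|.+1)%N.
  by rewrite ltnS -cardsT leq_imset_card.
pose im_card (f : {ffun P -> 'I_n}) : 'I_#|P|.+1 := Ordinal (im_le f).
rewrite /order_count -sum1_card (partition_big im_card xpredT) //=.
apply: eq_bigr => k _.
rewrite -[n in 'C(n, _)]card_ord -card_draws mulnC -sum_nat_const.
rewrite (partition_big (fun f : {ffun P -> 'I_n} => f @: [set: P])
          (mem [set A : {set 'I_n} | #|A| == k])) /=; last first.
  by move=> f /andP[_ /eqP <-]; rewrite inE.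
apply: eq_bigr => A; rewrite inE => /eqP cA.
rewrite -cA -card_image -sum1_card; apply: eq_bigl => f.
rewrite !inE -andbA; congr (_ && _); apply/andP/idP => [[]//|/eqP fA].
by rewrite fA eqxx; split=> //; apply/eqP/val_inj; rewrite /= fA.
Qed.

Lemma order_poly_exists :
  {p : {poly rat} | forall n, (0 < n)%N -> p.[n%:R] = (order_count n)%:R}.
Proof.
exists (\sum_(k < #|P|.+1) (onto_count k)%:R *: binom_poly k) => n _.
rewrite order_count_sum natr_sum horner_sum; apply: eq_bigr => k _.
by rewrite hornerZ binom_polyE natrM.
Qed.

Definition order_poly : {poly rat} := sval order_poly_exists.

Lemma order_polyE n : (0 < n)%N -> order_poly.[n%:R] = (order_count n)%:R.
Proof. by rewrite /order_poly; case: order_poly_exists => p; apply. Qed.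

Lemma order_poly_uniq (p : {poly rat}) :
  (forall n, (0 < n)%N -> p.[n%:R] = (order_count n)%:R) -> p = order_poly.
Proof. by move=> pE; apply: eq_poly_nat => n n0; rewrite pE // order_polyE. Qed.

End Invariants.

(* The recursion is on the fuel [m], which suffices once [#|P| <= m];
   [PsiE] below is the fuel-free recursion. *)
Fixpoint Psi_rec (m : nat) (P : labeledPoset) : {poly rat} :=
  if m is m'.+1 then
    if #|P| == 0%N then 1 else
    fdiff_inv (\sum_(S in natural_ideals P | S != set0)
                 Psi_rec m' (sub_poset (~: S)))
  else 1.

Definition Psi (P : labeledPoset) : {poly rat} := Psi_rec #|P| P.

Lemma card_sub_poset_setC (P : labeledPoset) (S : {set P}) :
  S != set0 -> (#|sub_poset (~: S)| < #|P|)%N.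
Proof.
rewrite -card_gt0 => S0; rewrite card_sub_poset -(cardsC S) -addn1.
by rewrite addnC leq_add2r.
Qed.

Lemma Psi_recE m (P : labeledPoset) : (#|P| <= m)%N -> Psi_rec m P = Psi P.
Proof.
rewrite /Psi; have [n] := ubnP #|P|; elim: n m P => // n IHn m P.
rewrite ltnS; case: m => [|m]; first by rewrite leqn0 => _ /eqP ->.
case cP: #|P| => [|c] /= le_n le_m; first by rewrite cP.
rewrite cP /=; congr fdiff_inv; apply: eq_bigr => S /andP[_ S0].
have lt_c : (#|sub_poset (~: S)| <= c)%N.
  by rewrite -ltnS -cP card_sub_poset_setC.
by rewrite !IHn ?(leq_trans _ le_n) ?(leq_trans lt_c).
Qed.

Lemma Psi_empty (P : labeledPoset) : #|P| = 0%N -> Psi P = 1.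
Proof. by rewrite /Psi => ->. Qed.

Lemma PsiE (P : labeledPoset) : (0 < #|P|)%N ->
  Psi P = fdiff_inv (\sum_(S in natural_ideals P | S != set0)
                       Psi (sub_poset (~: S))).
Proof.
move=> P0; rewrite {1}/Psi; case cP: #|P| P0 => [//|c] _ /=; rewrite cP /=.
congr fdiff_inv; apply: eq_bigr => S /andP[_ S0]; apply: Psi_recE.
by rewrite -ltnS -cP card_sub_poset_setC.
Qed.

(* Main.v *)
Require Import Defs.
From mathcomp Require Import all_boot all_order all_algebra.

(** The values of [Psi] at all natural numbers [n], including [n = 0], are the
    numbers of label-order-preserving maps into a chain of [n] elements: the
    fibre [S] of such a map over the least element of a chain of [n.+1] elements
    is a natural ideal, the map is determined by [S] and its restriction to the
    complement, and every such pair occurs. The term [S = set0] counts the maps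
    into a chain of [n] elements, so the sum over the nonempty [S] is the finite
    difference at [n]. *)

Set Implicit Arguments.
Unset Strict Implicit.
Unset Printing Implicit Defensive.

Import Order.TTheory GRing.Theory Num.Theory.
Local Open Scope ring_scope.

Lemma label_order_preservingP (P : labeledPoset) n (f : {ffun P -> 'I_n}) :
  reflect ((forall x y : P, (x <= y)%O -> (f x <= f y)%N) /\
           (forall x y : P, (y < x)%O -> (label x < label y)%N -> (f y < f x)%N))
          (label_order_preserving f).
Proof.
apply: (iffP andP) => -[f_le f_lt]; split.
- by move=> x y; have /forallP/(_ x)/forallP/(_ y)/implyP := f_le.
- move=> x y xy lxy; have /forallP/(_ x)/forallP/(_ y)/implyP := f_lt.
  by apply; rewrite xy.
- by apply/forallP=> x; apply/forallP=> y; apply/implyP; apply: f_le.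
- by apply/forallP=> x; apply/forallP=> y; apply/implyP=> /andP[]; apply: f_lt.
Qed.

Lemma natural_idealsP (P : labeledPoset) (S : {set P}) :
  reflect ((forall x y : P, x \in S -> (y <= x)%O -> y \in S) /\
           {in S &, forall x y : P, (x <= y)%O -> (label x <= label y)%N})
          (S \in natural_ideals P).
Proof.
rewrite inE; apply: (iffP andP) => -[S_down S_nat]; split.
- move=> x y Sx yx; have /forallP/(_ x)/forallP/(_ y)/implyP := S_down.
  by apply; rewrite Sx.
- move=> x y Sx Sy; have /forallP/(_ x)/implyP/(_ Sx) := S_nat.
  by move=> /forallP/(_ y)/implyP/(_ Sy)/implyP.
- by apply/forallP=> x; apply/forallP=> y; apply/implyP=> /andP[]; apply: S_down.
- apply/forallP=> x; apply/implyP=> Sx; apply/forallP=> y; apply/implyP=> Sy.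
  by apply/implyP; apply: S_nat.
Qed.

Definition zero_fiber (P : labeledPoset) n (f : {ffun P -> 'I_n}) : {set P} :=
  [set x | f x == 0 :> nat].

(** The fibre is down-closed because 0 is the least value. It is natural because a label descent
    along a strict relation would force a strict increase of [f], which is constant on the fibre. *)
Lemma zero_fiber_natural_ideal (P : labeledPoset) n (f : {ffun P -> 'I_n}) :
  label_order_preserving f -> zero_fiber f \in natural_ideals P.
Proof.
move=> /label_order_preservingP[f_le f_lt]; apply/natural_idealsP; split.
  move=> x y; rewrite !inE => /eqP fx /f_le.
  by rewrite fx leqn0.
move=> x y; rewrite !inE => /eqP fx /eqP fy.
rewrite le_eqVlt => /predU1P[-> //|xy].
by rewrite leqNgt; apply/negP=> /(f_lt _ _ xy); rewrite fx fy.
Qed.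

Section ExtendByZero.
Variables (P : labeledPoset) (S : {set P}) (n : nat).
Hypothesis S_nat : S \in natural_ideals P.

(** [lift ord0] is the shift by one, so [g] takes up the values above 0 and only points of [S] are
    sent to 0. *)
Definition extend_by_zero (g : {ffun sub_poset (~: S) -> 'I_n}) :
    {ffun P -> 'I_n.+1} :=
  [ffun x => if insub x is Some u then lift ord0 (g (u : sub_carrier (~: S)))
             else ord0].

Lemma extend_by_zero_val g (u : sub_poset (~: S)) :
  extend_by_zero g (val u) = lift ord0 (g u).
Proof. by rewrite ffunE valK. Qed.

Lemma extend_by_zero_in g x : x \in S -> extend_by_zero g x = ord0.
Proof. by move=> Sx; rewrite ffunE insubF // inE Sx. Qed.

Lemma extend_by_zero_inj : injective extend_by_zero.
Proof.
move=> g g' /ffunP gg'; apply/ffunP=> u; apply: (@lift_inj _ ord0).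
by rewrite -!extend_by_zero_val gg'.
Qed.

Lemma zero_fiber_extend g : zero_fiber (extend_by_zero g) = S.
Proof.
apply/setP=> x; rewrite inE; have [Sx|S'x] := boolP (x \in S).
  by rewrite extend_by_zero_in.
have Cx : x \in ~: S by rewrite inE.
by rewrite (extend_by_zero_val g (Sub x Cx : sub_carrier _)).
Qed.

Lemma extend_by_zero_preserving g :
  label_order_preserving (extend_by_zero g) = label_order_preserving g.
Proof.
apply/label_order_preservingP/label_order_preservingP => -[g_le g_lt]; split.
- by move=> u v /g_le; rewrite !extend_by_zero_val.
- by move=> u v /g_lt/[apply]; rewrite !extend_by_zero_val.
- move=> x y xy; have [Sx|S'x] := boolP (x \in S).
    by rewrite extend_by_zero_in.
  (* Down-closure of [S] excludes the one bad case, a positive value below a zero. *)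
  have S'y : y \notin S.
    by apply: contra S'x => Sy; have /natural_idealsP[+ _] := S_nat; apply; eauto.
  have Cx : x \in ~: S by rewrite inE.
  have Cy : y \in ~: S by rewrite inE.
  rewrite (extend_by_zero_val g (Sub x Cx : sub_carrier _)).
  rewrite (extend_by_zero_val g (Sub y Cy : sub_carrier _)).
  exact: g_le.
- move=> x y yx lxy; have [S_down S_lab] := natural_idealsP _ S_nat.
  (* Otherwise [y] lies in [S] too, and the descent [lxy] contradicts naturality of [S]. *)
  have S'x : x \notin S.
    apply/negP=> Sx; have Sy := S_down _ _ Sx (ltW yx).
    by have := S_lab _ _ Sy Sx (ltW yx); rewrite leqNgt lxy.
  have Cx : x \in ~: S by rewrite inE.
  rewrite (extend_by_zero_val g (Sub x Cx : sub_carrier _)).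
  have [Sy|S'y] := boolP (y \in S); first by rewrite extend_by_zero_in.
  have Cy : y \in ~: S by rewrite inE.
  rewrite (extend_by_zero_val g (Sub y Cy : sub_carrier _)).
  exact: g_lt.
Qed.

Lemma extend_by_zero_surj (f : {ffun P -> 'I_n.+1}) :
  zero_fiber f = S -> exists g, f = extend_by_zero g.
Proof.
move=> fS.
have in_S x : (x \in S) = (f x == 0 :> nat) by rewrite -fS inE.
(* Off the zero fibre the value of [f] is positive, hence a shift; its predecessor is the value of
   [g]. *)
have fP (u : sub_poset (~: S)) : exists i, lift ord0 i == f (val u).
  have : ord0 != f (val u) by rewrite eq_sym -val_eqE -in_S -in_setC (valP u).
  by move=> /unlift_some[i ->]; exists i.
exists [ffun u => xchoose (fP u)]; apply/ffunP=> x.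
have [Sx|S'x] := boolP (x \in S).
  by rewrite extend_by_zero_in //; apply/val_inj/eqP; rewrite -in_S.
have Cx : x \in ~: S by rewrite inE.
rewrite (extend_by_zero_val _ (Sub x Cx : sub_carrier _)) ffunE.
by rewrite (eqP (xchooseP (fP _))).
Qed.

Lemma order_count_sub :
  order_count (sub_poset (~: S)) n =
  #|[set f : {ffun P -> 'I_n.+1} |
      label_order_preserving f & zero_fiber f == S]|.
Proof.
rewrite /order_count -(card_imset _ extend_by_zero_inj).
apply: eq_card => f; rewrite inE; apply/imsetP/andP => [[g]|[f_pres /eqP fS]].
  by rewrite inE => g_pres ->; rewrite extend_by_zero_preserving zero_fiber_extend.
have [g fE] := extend_by_zero_surj fS.
by exists g => //; rewrite inE -extend_by_zero_preserving -fE.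
Qed.

End ExtendByZero.

Lemma order_countS (P : labeledPoset) n :
  order_count P n.+1 =
  (\sum_(S in natural_ideals P) order_count (sub_poset (~: S)) n)%N.
Proof.
rewrite {1}/order_count -sum1_card.
rewrite (partition_big (@zero_fiber P n.+1) (mem (natural_ideals P))) /=; last first.
  by move=> f; rewrite inE => /zero_fiber_natural_ideal.
apply: eq_bigr => S S_nat; rewrite order_count_sub //.
by rewrite -sum1_card; apply: eq_bigl => f; rewrite !inE.
Qed.

(** Needed for the term of the empty ideal: its complement gives a labeled poset that is isomorphic
    to [P] but not the same record. *)
Lemma order_count_iso (P Q : labeledPoset) (h : P -> Q) n :
  bijective h -> {mono h : x y / (x <= y)%O} ->
  (forall x, label (h x) = label x) -> order_count P n = order_count Q n.
Proof.
move=> [k hK kH] h_le h_lab; have h_lt := leW_mono h_le.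
pose pull (f : {ffun Q -> 'I_n}) : {ffun P -> 'I_n} := [ffun x => f (h x)].
have pull_inj : injective pull.
  move=> f f' /ffunP ff'; apply/ffunP=> y.
  by have := ff' (k y); rewrite !ffunE kH.
have pull_pres f : label_order_preserving (pull f) = label_order_preserving f.
  apply/label_order_preservingP/label_order_preservingP => -[f_le f_lt]; split.
  - by move=> x y; rewrite -[x]kH -[y]kH h_le => /f_le; rewrite !ffunE.
  - move=> x y; rewrite -[x]kH -[y]kH h_lt !h_lab.
    by move=> /f_lt/[apply]; rewrite !ffunE.
  - by move=> x y xy; rewrite !ffunE f_le // h_le.
  - by move=> x y yx lxy; rewrite !ffunE f_lt ?h_lt ?h_lab.
rewrite /order_count -[RHS](card_imset _ pull_inj); apply: eq_card => f.
rewrite inE; apply/idP/imsetP => [f_pres|[g + ->]]; last by rewrite inE pull_pres.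
have fE : f = pull [ffun y => f (k y)] by apply/ffunP=> x; rewrite !ffunE hK.
by exists [ffun y => f (k y)]; rewrite // inE -pull_pres -fE.
Qed.

Lemma order_count_setT (P : labeledPoset) (A : {set P}) n :
  A = setT -> order_count (sub_poset A) n = order_count P n.
Proof.
move=> AT; have inA x : x \in A by rewrite AT inE.
apply: (@order_count_iso (sub_poset A) P (val : sub_carrier A -> P)) => //.
exists (fun x => Sub x (inA x) : sub_carrier A) => [u|x]; last exact: SubK.
by apply: val_inj; rewrite SubK.
Qed.

Lemma set0_natural_ideal (P : labeledPoset) : set0 \in natural_ideals P.
Proof. by apply/natural_idealsP; split=> x y; rewrite inE. Qed.

(** The case [n = 0] is included: the empty function is still a map, in agreement with the constant
    polynomial 1. *)
Lemma order_count_empty (P : labeledPoset) n : #|P| = 0%N -> order_count P n = 1%N.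
Proof.
move=> P0; have P_empty (x : P) : False by have := fintype0 x P0.
rewrite /order_count (eq_card (B := {ffun P -> 'I_n})) => [|f].
  by rewrite card_ffun P0 expn0.
by rewrite inE; apply/label_order_preservingP; split=> x.
Qed.

(** This is the counting side of the normalisation [fdiff_inv0]. *)
Lemma order_count0 (P : labeledPoset) : (0 < #|P|)%N -> order_count P 0 = 0%N.
Proof.
by move=> /card_gt0P[x _]; apply: eq_card0 => f; case: (f x).
Qed.

(** Strong induction on the cardinality of [P], then induction on [n]. Starting at [n = 0] lets the
    condition at 0 in [fdiff_inv] serve as base case. *)
Lemma Psi_order_count (P : labeledPoset) n :
  (Psi P).[n%:R] = (order_count P n)%:R.
Proof.
have [m] := ubnP #|P|; elim: m P n => // m IHm P n; rewrite ltnS => le_m.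
have [P0|P_gt0] := posnP #|P|.
  by rewrite Psi_empty // order_count_empty // hornerE.
rewrite PsiE //; elim: n => [|n IHn]; first by rewrite fdiff_inv0 order_count0.
(* At [n] this reads: the value at [n.+1] is the value at [n] plus the sum over the nonempty
   ideals. *)
have := congr1 (horner^~ n%:R) (fdiff_invK
  (\sum_(S in natural_ideals P | S != set0) Psi (sub_poset (~: S)))).
rewrite /= fdiffE natr1 IHn => /eqP; rewrite subr_eq => /eqP ->.
(* The term split off is [order_count P n], which matches the value at [n]; the other terms agree by
   induction on cardinality. *)
rewrite order_countS [in RHS](bigD1 set0) ?set0_natural_ideal //=.
rewrite order_count_setT ?setC0 // natrD addrC; congr (_ + _).
rewrite horner_sum natr_sum; apply: eq_bigr => S /andP[_ S0].
by apply: IHm; apply: leq_trans le_m; apply: card_sub_poset_setC.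
Qed.

Theorem proposition3p4 (P : labeledPoset) : Psi P = order_poly P.
Proof. by apply: order_poly_uniq => n _; apply: Psi_order_count. Qed.
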